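(* Let $\mathfrak{M}=(\mathbf{M},\models,\mathcal{P}(\mathscr{L}))$ be a normal abstract model structure and $\tau_N$ the topology on $\mathbf{M}$ generated by $\{\mathbf{M}\setminus\mathsf{Mod}(\{\alpha\})\mid\alpha\in\mathscr{L}\}$ as a subbase. Then $\mathfrak{M}$ is compact iff for every finitely satisfiable $\Sigma\subseteq\mathscr{L}$, every ultrafilter $\mathcal{U}$ on $\mathsf{FinSet}(\Sigma)$, and every family $(m_{\Sigma_0})_{\Sigma_0\in\mathsf{FinSet}(\Sigma)}$ of elements of $\mathbf{M}$, the family $(m_{\Sigma_0})$ has a $\mathcal{U}$-ultralimit in $(\mathbf{M},\tau_N)$.
   Context: An abstract model structure is a triple $(\mathbf{M},\models,\mathcal{P}(\mathscr{L}))$ with $\mathbf{M}\neq\emptyset$, $\mathscr{L}$ a set and $\models\,\subseteq\mathbf{M}\times\mathcal{P}(\mathscr{L})$. It is normal if for all $m$ and $\Gamma$: $m\models\Gamma$ iff $m\models\{\alpha\}$ for all $\alpha\in\Gamma$. $\mathsf{Mod}(\Gamma)=\{m\in\mathbf{M}\mid m\models\Gamma\}$. $\Gamma$ is satisfiable if $\mathsf{Mod}(\Gamma)\ne\emptyset$, finitely satisfiable if every finite subset is satisfiable; $\mathfrak{M}$ is compact if for all $\Gamma\subseteq\mathscr{L}$, $\Gamma$ is satisfiable iff finitely satisfiable. $\mathsf{FinSet}(\Sigma)$ is the set of finite subsets of $\Sigma$. For a topological space $(X,\tau)$, a family $(x_i)_{i\in I}$ and an ultrafilter $\mathcal{U}$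 on $I$, $x\in X$ is a $\mathcal{U}$-ultralimit of $(x_i)$ if for every $\tau$-open $U\ni x$, $\{i\in I\mid x_i\in U\}\in\mathcal{U}$. *)

(* Defs.v *)
From HB Require Import structures.
From mathcomp Require Import all_boot all_order finmap.
From mathcomp Require Import boolp classical_sets functions cardinality filter.
From mathcomp Require Import topology.

Set Implicit Arguments.
Unset Strict Implicit.
Unset Printing Implicit Defensive.

Local Open Scope classical_set_scope.

Record model_structure := ModelStructure {
  models : Type;
  language : Type;
  sat : models -> set language -> Prop;
  models_nonempty : [set: models] !=set0
}.

Section ModelStructure.
Variable S : model_structure.
Implicit Types (m : models S) (Gamma Sigma : set (language S)).

Definition normal_structure : Prop :=
  forall m Gamma,
    sat m Gamma <-> (forall alpha, Gamma alpha -> sat m [set alpha]).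

Definition Mod Gamma : set (models S) := [set m | sat m Gamma].

Definition satisfiable Gamma : Prop := Mod Gamma !=set0.

Definition fin_subsets Sigma : set (set (language S)) :=
  [set Sigma0 | Sigma0 `<=` Sigma /\ finite_set Sigma0].

Definition finitely_satisfiable Gamma : Prop :=
  forall Gamma0, fin_subsets Gamma Gamma0 -> satisfiable Gamma0.

Definition compact_structure : Prop :=
  forall Gamma, satisfiable Gamma <-> finitely_satisfiable Gamma.

End ModelStructure.

(* The models with the topology generated by the subbase of all complements
   of Mod [set alpha]; topologicalType needs a choiceType carrier, whence
   {classic _}. *)
Definition tauN (S : model_structure) : Type := {classic models S}.

HB.instance Definition _ (S : model_structure) := Choice.on (tauN S).

(* The subbase is indexed by itself, as the factory wants a pointed index type
   and the language may be empty. *)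
HB.instance Definition _ (S : model_structure) :=
  isSubBaseTopological.Build (tauN S)
    [set ~` Mod [set alpha] | alpha in [set: language S]] id.

Definition is_ultralimit (X : topologicalType) (I : Type) (U : set_system I)
    (x_ : I -> X) (x : X) : Prop :=
  forall V : set X, open V -> V x -> U [set i | V (x_ i)].

(* Main.v *)
Require Import Defs.
From mathcomp Require Import all_boot all_order finmap.
From mathcomp Require Import boolp classical_sets functions cardinality filter.
From mathcomp Require Import topology.

Local Open Scope classical_set_scope.

(** Testing on the subbase suffices, so [m] is a [U]-ultralimit of
    [(m_i)] as soon as every [alpha] that [U]-almost all [m_i] satisfy also
    holds in [m].  The set of these [alpha] is finitely satisfiable, so
    compactness provides [m].  Conversely, let [m_i] be a model of the finite set
    [i], and let [U] contain every cone [{i | i0 `<=` i}]: an ultralimit of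
    [(m_i)] is then a model of [Sigma]. *)

Lemma filter_bigcap_finite {T I : Type} {D : set I} (f : I -> set T)
    {F : set_system T} :
  Filter F -> finite_set D -> (forall i, D i -> F (f i)) ->
  F (\bigcap_(i in D) f i).
Proof.
move=> FF /(@finite_fsetP {classic I})[X ->].
exact: (@filter_bigI _ {classic I}).
Qed.

(** An open set is a union of finite intersections of subbasic sets, and a filter is closed under
    finite intersections and supersets. *)
Lemma tauN_ultralimitP {S : model_structure} {I : Type} {U : set_system I}
    {x_ : I -> models S} {m : models S} : Filter U ->
  is_ultralimit (X := tauN S) U x_ m <->
  forall alpha, ~ sat m [set alpha] -> U [set i | ~ sat (x_ i) [set alpha]].
Proof.
move=> FU; split=> [lim alpha nma | subbase V].
  apply: (lim (~` Mod [set alpha])) => //.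
  (* A subbasic set is open as a one-member union of a one-member intersection. *)
  exists [set ~` Mod [set alpha]]; last by rewrite bigcup_set1.
  move=> _ ->; exists [fset (~` Mod [set alpha] : set (tauN S))]%fset.
    by move=> A /fset1P ->; apply/mem_set; exists alpha.
  by rewrite set_fset1 bigcap_set1.
case=> B baseB <- [W BW Wm]; have [X Xsub XW] := baseB _ BW.
rewrite -XW in Wm.
have : U (\bigcap_(A in [set` X]) (x_ @^-1` (A : set (models S)))).
  apply: filter_bigI => A XA; have := Wm A XA.
  by have [alpha _ <-] := set_mem (Xsub A XA); exact: subbase.
by apply: filterS => i Xi; exists W => //; rewrite -XW; exact: Xi.
Qed.

Section Normal.
Context {S : model_structure} (S_normal : normal_structure S).
Implicit Types Sigma Gamma : set (language S).

Lemma satisfiable_finitely Gamma :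
  satisfiable Gamma -> finitely_satisfiable Gamma.
Proof.
case=> m mG G0 [G0G _]; exists m; apply/S_normal => alpha /G0G.
by apply: (S_normal m Gamma).1.
Qed.

(** Finitely many members of [U] share an index [i], as [U] is proper; by normality [x_ i] is then a
    model of the finite subset. *)
Lemma almost_sure_theory_finitely_satisfiable {I : Type} {U : set_system I}
    (x_ : I -> models S) : ProperFilter U ->
  finitely_satisfiable [set alpha | U [set i | sat (x_ i) [set alpha]]].
Proof.
move=> FU G0 [G0U fin0].
have /filter_ex[i satG0] :
    U (\bigcap_(alpha in G0) [set i | sat (x_ i) [set alpha]]).
  exact: filter_bigcap_finite.
by exists (x_ i); apply/S_normal.
Qed.

(** The cone over a union lies in the cones over both parts, and each cone contains its vertex. *)
Lemma cone_filter Sigma :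
  ProperFilter (filter_from setT
    (fun A : fin_subsets Sigma => [set B : fin_subsets Sigma | val A `<=` val B])).
Proof.
apply: filter_from_proper => [|A _]; last by exists A.
apply: filter_fromT_filter => [|A B].
  have fin0 : fin_subsets Sigma set0 by split.
  by exists (SigSub (mem_set fin0)).
have [As Af] := set_mem (valP A); have [Bs Bf] := set_mem (valP B).
have finAB : fin_subsets Sigma (val A `|` val B).
  by split; [rewrite subUset | rewrite finite_setU].
by exists (SigSub (mem_set finAB)) => C /=; rewrite subUset.
Qed.

End Normal.

Theorem theorem3p39 (S : model_structure) (S_normal : normal_structure S) :
  compact_structure S <->
  (forall Sigma : set (language S), finitely_satisfiable Sigma ->
   forall U : set_system (fin_subsets Sigma), UltraFilter U ->
   forall m_ : fin_subsets Sigma -> models S,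
   exists m : models S, is_ultralimit (X := tauN S) U m_ m).
Proof.
split=> [comp Sigma _ U UU m_ | lim Sigma].
  have [m mT] := (comp _).2
    (almost_sure_theory_finitely_satisfiable S_normal m_ (@ultra_proper _ U _)).
  exists m; apply/tauN_ultralimitP => alpha nma.
  (* Either [alpha] lies in the almost sure theory, which [m] models, contradicting [nma], or the
     complement is in [U], as required. *)
  have [Ua|//] := in_ultra_setVsetC [set i | sat (m_ i) [set alpha]] UU.
  by case: nma; apply: (S_normal m _).1 mT _ Ua.
split=> [|finS]; first exact: satisfiable_finitely.
have [|m_ m_sat] :=
    @choice (fin_subsets Sigma) (models S) (fun A m => sat m (val A)).
  by move=> A; exact: finS (set_mem (valP A)).
have [U [UU coneU]] := ultraFilterLemma (cone_filter Sigma).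
have [m /tauN_ultralimitP mlim] := lim Sigma finS U UU m_.
exists m; apply/S_normal => alpha Salpha; apply: contrapT => /mlim Unalpha.
(* The cone over [[set alpha]] is in [U], so some [B] in it has [m_ B] failing [alpha], although
   [m_ B] is a model of [B]. *)
have fin1 : fin_subsets Sigma [set alpha] by split=> // _ ->.
have Ualpha : U [set B | [set alpha] `<=` val B].
  by apply: coneU; exists (SigSub (mem_set fin1)).
have [B [nB aB]] := filter_ex (filterI Unalpha Ualpha).
by apply: nB; apply: (S_normal _ _).1 (m_sat B) _ (aB _ _).
Qed.
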